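(* The extension $\mathsf{HLC}^\sharp+\top\mathsf F$ of $\mathsf{HLC}^\sharp$ by the explicit fixed point principle $\top\mathsf F$ proves the strong Löb principle: for every formula $\phi$ of $\mathbb L(\rightsquigarrow)$, $$\mathsf{HLC}^\sharp+\top\mathsf F\vdash(\Box\phi\to\phi)\to\phi.$$
   Context: Formulas of $\mathbb L(\rightsquigarrow)$ are built from propositional variables, $\top,\bot$, and binary connectives $\wedge,\vee,\to,\rightsquigarrow$. Abbreviations: $(\phi\leftrightarrow\psi):=((\phi\to\psi)\wedge(\psi\to\phi))$ and $\Box\phi:=(\top\rightsquigarrow\phi)$. $\chi[r:\phi]$ denotes the result of substituting $\phi$ for $r$ in $\chi$. A formula $\chi$ is modalised in $r$ if every occurrence of $r$ in $\chi$ is in the scope of an occurrence of $\rightsquigarrow$. The system $\mathsf{HLC}^\sharp$ is axiomatised by all axioms and rules of intuitionistic propositional logic, the rule: from $\vdash\phi\to\psi$ infer $\vdash\phi\rightsquigarrow\psi$, and the axiom schemes $((\phi\rightsquigarrow\psi)\wedge(\psi\rightsquigarrow\chi))\to(\phi\rightsquigarrow\chi)$, $((\phi\rightsquigarrow\psi)\wedge(\phi\rightsquigarrow\chi))\to(\phi\rightsquigarrow(\psi\wedge\chi))$, $((\phi\rightsquigarrow\chi)\wedge(\psi\rightsquigarrow\chi))\to((\phi\vee\psi)\rightsquigarrow\chi)$. The principle $\top\mathsf F$ consists of all formulas $\chi[r:\top]\leftrightarrow\chi[r:\chi[r:\top]]$, where $r$ is a propositional variable and $\chi$ is modalised in $r$.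 $\mathsf{HLC}^\sharp+\top\mathsf F$ is $\mathsf{HLC}^\sharp$ with these added as axioms (all rules applying to the extended system). *)

(* Defs.v *)
Inductive formula : Type :=
| Var : nat -> formula
| Top : formula
| Bot : formula
| And : formula -> formula -> formula
| Or : formula -> formula -> formula
| Imp : formula -> formula -> formula
| Lewis : formula -> formula -> formula.

Declare Scope formula_scope.
Delimit Scope formula_scope with form.
Bind Scope formula_scope with formula.

Notation "A /\ B" := (And A B) : formula_scope.
Notation "A \/ B" := (Or A B) : formula_scope.
Notation "A ~> B" := (Lewis A B) (at level 88, no associativity) : formula_scope.
Notation "A --> B" := (Imp A B) (at level 90, right associativity) : formula_scope.

Definition Iff (A B : formula) : formula := (A --> B) /\ (B --> A).
Definition Box (A : formula) : formula := Top ~> A.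

Notation "A <--> B" := (Iff A B) (at level 95, no associativity) : formula_scope.

(* [subst r B C] is C[r:B]; the language has no binders. *)
Fixpoint subst (r : nat) (B C : formula) : formula :=
  match C with
  | Var p => if Nat.eqb p r then B else Var p
  | Top => Top
  | Bot => Bot
  | And C1 C2 => And (subst r B C1) (subst r B C2)
  | Or C1 C2 => Or (subst r B C1) (subst r B C2)
  | Imp C1 C2 => Imp (subst r B C1) (subst r B C2)
  | Lewis C1 C2 => Lewis (subst r B C1) (subst r B C2)
  end.

(* Every occurrence of r lies below some [Lewis] node, so nothing is required
   of the arguments of [Lewis]. *)
Fixpoint modalised (r : nat) (C : formula) : Prop :=
  match C with
  | Var p => p <> r
  | Top => True
  | Bot => True
  | And C1 C2 => modalised r C1 /\ modalised r C2
  | Or C1 C2 => modalised r C1 /\ modalised r C2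
  | Imp C1 C2 => modalised r C1 /\ modalised r C2
  | Lewis _ _ => True
  end.

(* Theorems of HLC# extended with the formulas in [Ax] as axioms; there are no
   local assumptions, so [prov_Lewis] applies to theorems only. *)
Inductive HLC_sharp_plus (Ax : formula -> Prop) : formula -> Prop :=
| prov_Ax A : Ax A -> HLC_sharp_plus Ax A
| prov_K A B : HLC_sharp_plus Ax (A --> (B --> A))
| prov_S A B C :
    HLC_sharp_plus Ax ((A --> (B --> C)) --> ((A --> B) --> (A --> C)))
| prov_AndI A B : HLC_sharp_plus Ax (A --> (B --> (A /\ B)))
| prov_AndE1 A B : HLC_sharp_plus Ax ((A /\ B) --> A)
| prov_AndE2 A B : HLC_sharp_plus Ax ((A /\ B) --> B)
| prov_OrI1 A B : HLC_sharp_plus Ax (A --> (A \/ B))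
| prov_OrI2 A B : HLC_sharp_plus Ax (B --> (A \/ B))
| prov_OrE A B C :
    HLC_sharp_plus Ax ((A --> C) --> ((B --> C) --> ((A \/ B) --> C)))
| prov_Top : HLC_sharp_plus Ax Top
| prov_Bot A : HLC_sharp_plus Ax (Bot --> A)
| prov_MP A B :
    HLC_sharp_plus Ax (A --> B) -> HLC_sharp_plus Ax A -> HLC_sharp_plus Ax B
| prov_Lewis A B :
    HLC_sharp_plus Ax (A --> B) -> HLC_sharp_plus Ax (A ~> B)
| prov_Tr A B C :
    HLC_sharp_plus Ax (((A ~> B) /\ (B ~> C)) --> (A ~> C))
| prov_KAnd A B C :
    HLC_sharp_plus Ax (((A ~> B) /\ (A ~> C)) --> (A ~> (B /\ C)))
| prov_Di A B C :
    HLC_sharp_plus Ax (((A ~> C) /\ (B ~> C)) --> ((A \/ B) ~> C)).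

Definition HLC_sharp : formula -> Prop := HLC_sharp_plus (fun _ => False).

Inductive TopF : formula -> Prop :=
| TopF_intro (r : nat) (C : formula) :
    modalised r C ->
    TopF (subst r Top C <--> subst r (subst r Top C) C).

(* Main.v *)
Require Import Defs.
From Stdlib Require Import PeanoNat Lia.

(** The strong Löb principle for [phi] is the single instance of the fixed
    point principle given by [C := Box r --> phi], with [r] fresh for [phi].
    Such a [C] is modalised in [r], and [C[r:Top]] is [Box Top --> phi], which
    is equivalent to [phi] because [Box Top] is a theorem
    ([prov_discharge_theorem]). As [Box] is monotone ([prov_Box_mono]), the
    second member [Box (C[r:Top]) --> phi] of the fixed point equivalence
    follows from [Box phi --> phi], so the equivalence turns [Box phi --> phi]
    into [phi]. *)

Fixpoint fresh (r : nat) (A : formula) : Prop :=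
  match A with
  | Var p => p <> r
  | Top | Bot => True
  | And A1 A2 | Or A1 A2 | Imp A1 A2 | Lewis A1 A2 => fresh r A1 /\ fresh r A2
  end.

Lemma fresh_modalised r A : fresh r A -> modalised r A.
Proof. induction A; simpl; tauto. Qed.

Lemma subst_fresh r B A : fresh r A -> subst r B A = A.
Proof.
  induction A as [p| | | | | |]; simpl; intros H; trivial.
  { now destruct (Nat.eqb_spec p r). }
  all: destruct H; f_equal; auto.
Qed.

Fixpoint var_bound (A : formula) : nat :=
  match A with
  | Var p => S p
  | Top | Bot => 0
  | And A1 A2 | Or A1 A2 | Imp A1 A2 | Lewis A1 A2 =>
      Nat.max (var_bound A1) (var_bound A2)
  end.

Lemma fresh_above_var_bound r A : var_bound A <= r -> fresh r A.
Proof.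
  induction A; simpl; intros H; trivial; try lia.
  all: split; [apply IHA1 | apply IHA2]; lia.
Qed.

Lemma prov_imp_refl Ax A : HLC_sharp_plus Ax (A --> A).
Proof.
  apply (prov_MP _ (A --> (A --> A))); [| apply prov_K].
  apply (prov_MP _ (A --> ((A --> A) --> A))); [apply prov_S | apply prov_K].
Qed.

Lemma prov_imp_weaken Ax A B : HLC_sharp_plus Ax B -> HLC_sharp_plus Ax (A --> B).
Proof. apply prov_MP, prov_K. Qed.

Lemma prov_imp_MP Ax A B C :
  HLC_sharp_plus Ax (A --> (B --> C)) -> HLC_sharp_plus Ax (A --> B) ->
  HLC_sharp_plus Ax (A --> C).
Proof. intros H; apply prov_MP; revert H; apply prov_MP, prov_S. Qed.

Lemma prov_imp_trans Ax A B C :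
  HLC_sharp_plus Ax (A --> B) -> HLC_sharp_plus Ax (B --> C) ->
  HLC_sharp_plus Ax (A --> C).
Proof.
  intros HAB HBC; apply (prov_imp_MP _ _ B); [now apply prov_imp_weaken | exact HAB].
Qed.

Lemma prov_imp_mono_l Ax A B C :
  HLC_sharp_plus Ax (A --> B) -> HLC_sharp_plus Ax ((B --> C) --> (A --> C)).
Proof.
  intros H; apply (prov_imp_MP _ _ (A --> B)); [| now apply prov_imp_weaken].
  apply (prov_imp_trans _ _ (A --> (B --> C))); [apply prov_K | apply prov_S].
Qed.

Lemma prov_discharge_theorem Ax A B :
  HLC_sharp_plus Ax A -> HLC_sharp_plus Ax ((A --> B) --> B).
Proof.
  intros H; apply (prov_imp_MP _ _ A);
    [apply prov_imp_refl | now apply prov_imp_weaken].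
Qed.

(** The implication becomes [A ~> B] by the rule for theorems, and is then
    appended to [Top ~> A] by transitivity of [~>]. *)
Lemma prov_Box_mono Ax A B :
  HLC_sharp_plus Ax (A --> B) -> HLC_sharp_plus Ax (Box A --> Box B).
Proof.
  intros H; apply (prov_imp_trans _ _ (Box A /\ (A ~> B))); [| apply prov_Tr].
  apply (prov_imp_MP _ _ (A ~> B)); [apply prov_AndI |].
  now apply prov_imp_weaken, prov_Lewis.
Qed.

Theorem theorem3p13 (phi : formula) :
  HLC_sharp_plus TopF ((Box phi --> phi) --> phi).
Proof.
  set (r := var_bound phi).
  assert (Hr : fresh r phi) by now apply fresh_above_var_bound.
  assert (Hfix : HLC_sharp_plus TopF
    ((Box Top --> phi) <--> (Box (Box Top --> phi) --> phi))).
  { assert (Hmod : modalised r (Box (Var r) --> phi))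
      by now split; [| apply fresh_modalised].
    pose proof (prov_Ax _ _ (TopF_intro r _ Hmod)) as H.
    simpl in H; rewrite Nat.eqb_refl, !subst_fresh in H by exact Hr.
    exact H. }
  assert (Hphi : HLC_sharp_plus TopF ((Box Top --> phi) --> phi))
    by apply prov_discharge_theorem, prov_Lewis, prov_imp_refl.
  apply (prov_imp_trans _ _ (Box (Box Top --> phi) --> phi)).
  - now apply prov_imp_mono_l, prov_Box_mono.
  - apply (prov_imp_trans _ _ (Box Top --> phi)); [| exact Hphi].
    exact (prov_MP _ _ _ (prov_AndE2 _ _ _) Hfix).
Qed.
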